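(* Let $A\in\mathbb{R}^{m\times n}$ with $m<n$, let $x\in\mathbb{R}^n$, $\eta\in\mathbb{R}^m$, $y=Ax+\eta$, let $k\ge1$ be an integer, $S=\mathcal{L}_k(x)$, and let $\sigma_1,\sigma_m$ be the largest and smallest ($m$-th) singular values of $A$. Write $\gamma=\dfrac{1}{3\sqrt{\frac{1+\delta_{3k}}{1-\delta_{3k}}}+1}$. Suppose $\delta_{3k}<0.2119$, $$\epsilon>\max\left\{\sigma_1^2,\ \left(\frac{\sigma_1^2-\sigma_m^2}{\gamma-\delta_{3k}}-1\right)\sigma_1^2\right\},$$ and $$\epsilon+\sigma_1^2+(\delta_{3k}-\gamma)\frac{\epsilon+\sigma_1^2}{\sigma_1^2}<\lambda\le\epsilon+\sigma_m^2 .$$ Let $\{x^p\}$ be a sequence generated by the NTROT algorithm with these $A,y,k,\epsilon,\lambda$. Then for every $p\ge0$ for which $x^p$ is $k$-sparse (in particular for all $p\ge1$, and $p=0$ if $x^0$ is $k$-sparse), $$\|x^{p+1}-x_S\|_2\le\rho\|x^p-x_S\|_2+\tau\|Ax_{\overline S}+\eta\|_2,$$ where $$\rho=\sqrt{\frac{1+\delta_k}{1-\delta_{2k}}}\left(\delta_{2k}+2\delta_{3k}+3\sigma_1^2-\frac{3\lambda\sigma_1^2}{\epsilon+\sigma_1^2}\right)+\delta_{3k}+\sigma_1^2-\frac{\lambda\sigma_1^2}{\epsilon+\sigma_1^2}<1,$$ $$\tau=\frac{1}{\sqrt{1-\delta_{2k}}}\left(\frac{3\lambda\sigma_1\sqrt{1+\delta_k}}{\epsilon+\sigma_1^2}+2\right)+\frac{\lambda\sigma_1}{\epsilon+\sigma_1^2}.$$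 In particular, if $x$ is $k$-sparse and $\eta=0$, then $x^p\to x$ as $p\to\infty$.
   Context: Notation: $\|\cdot\|_2$ is the Euclidean norm; a vector is $k$-sparse if it has at most $k$ nonzero entries. For $\Omega\subseteq\{1,\dots,n\}$, $\overline\Omega$ is its complement and $x_\Omega$ is the vector obtained from $x$ by keeping the entries indexed by $\Omega$ and setting the others to zero. $\mathcal{L}_k(u)$ denotes the index set of the $k$ largest magnitudes of $u$ (ties broken arbitrarily), and $\mathcal{H}_k(u)=u_{\mathcal{L}_k(u)}$ is the hard thresholding operator. $u\otimes w$ is the entrywise (Hadamard) product; $\mathbf e=(1,\dots,1)^T\in\mathbb{R}^n$; $I$ is the $n\times n$ identity; vector inequalities are entrywise. The $q$-th order restricted isometry constant $\delta_q$ of $A$ is the smallest $\delta\ge0$ such that $(1-\delta)\|z\|_2^2\le\|Az\|_2^2\le(1+\delta)\|z\|_2^2$ for all $q$-sparse $z\in\mathbb{R}^n$. NTROT algorithm (Newton-type relaxed optimal $k$-thresholding): given $A$, $y$, $k$, $\epsilon>0$, $\lambda>0$ and an initial point $x^0\in\mathbb{R}^n$, for $p=0,1,2,\dots$ set $u^p=x^p+\lambda(A^TA+\epsilon I)^{-1}A^T(y-Ax^p)$, $w^p\in\arg\min_w\{\|y-A(u^p\otimes w)\|_2^2:\ \mathbf e^Tw=k,\ 0\le w\le\mathbf e\}$, $x^{p+1}=\mathcal{H}_k(u^p\otimes w^p)$. *)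

(* Defs.v *)
From HB Require Import structures.
From mathcomp Require Import all_boot all_order all_algebra.
From mathcomp Require Import all_classical all_reals all_analysis.
Set Implicit Arguments. Unset Strict Implicit. Unset Printing Implicit Defensive.
Import Order.TTheory GRing.Theory Num.Theory.
Local Open Scope ring_scope.

Section Defs.
Variable R : realType.

Definition norm2 {n : nat} (z : 'cV[R]_n) : R := Num.sqrt (\sum_i (z i 0) ^+ 2).

Definition supp {n : nat} (z : 'cV[R]_n) : {set 'I_n} := [set i | z i 0 != 0].
Definition sparse {n : nat} (k : nat) (z : 'cV[R]_n) : Prop := (#|supp z| <= k)%N.

Definition restrict_idx {n : nat} (Om : {set 'I_n}) (z : 'cV[R]_n) : 'cV[R]_n :=
  \col_i (if i \in Om then z i 0 else 0).

Definition had {n : nat} (u w : 'cV[R]_n) : 'cV[R]_n := \col_i (u i 0 * w i 0).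

(* Om is an admissible choice of L_k(u): an index set of the k largest
   magnitudes of u (ties broken arbitrarily). If k > n, Om is all of 'I_n. *)
Definition is_Lk {n : nat} (k : nat) (u : 'cV[R]_n) (Om : {set 'I_n}) : Prop :=
  #|Om| = minn k n /\
  (forall i j, i \in Om -> j \notin Om -> `|u j 0| <= `|u i 0|).

Definition is_Hk {n : nat} (k : nat) (u x' : 'cV[R]_n) : Prop :=
  exists Om, is_Lk k u Om /\ x' = restrict_idx Om u.

(* q-th order restricted isometry constant: the smallest delta >= 0 with the RIP
   inequality for all q-sparse z (the infimum, which is attained) *)
Definition ric {m n : nat} (A : 'M[R]_(m, n)) (q : nat) : R :=
  inf [set d : R | 0 <= d /\
        forall z : 'cV[R]_n, sparse q z ->
          (1 - d) * norm2 z ^+ 2 <= norm2 (A *m z) ^+ 2 /\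
          norm2 (A *m z) ^+ 2 <= (1 + d) * norm2 z ^+ 2].

(* singular values of A in R^{m x n} (m <= n): nonnegative square roots of
   the eigenvalues of A A^T *)
Definition is_singular_value {m n : nat} (A : 'M[R]_(m, n)) (s : R) : Prop :=
  0 <= s /\ eigenvalue (A *m A^T) (s ^+ 2).

Definition feasible_w {n : nat} (k : nat) (w : 'cV[R]_n) : Prop :=
  \sum_i w i 0 = k%:R /\ (forall i, 0 <= w i 0 <= 1).

Definition NTROT_seq {m n : nat} (A : 'M[R]_(m, n)) (y : 'cV[R]_m) (k : nat)
  (eps lam : R) (xs us ws : nat -> 'cV[R]_n) : Prop :=
  forall p : nat,
    us p = xs p + lam *: (invmx (A^T *m A + eps%:M) *m (A^T *m (y - A *m xs p))) /\
    (feasible_w k (ws p) /\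
     forall w, feasible_w k w ->
       norm2 (y - A *m had (us p) (ws p)) ^+ 2 <= norm2 (y - A *m had (us p) w) ^+ 2) /\
    is_Hk k (had (us p) (ws p)) (xs p.+1).

End Defs.

(* Main.v *)
(* Write h = x^p - x_S and G = A A^T, whose spectrum lies in [sm^2, s1^2]. Since
   (A^T A + eps)^-1 A^T = A^T (G + eps)^-1, the Newton map differs from the gradient map
   h - A^T A h by A^T (1 - lam (G + eps)^-1) A, a positive operator of norm at most
   s1^2 - lam s1^2 / (eps + s1^2); the gradient map is controlled on small supports by the
   restricted isometry constants. The weights w^p form a point of the hypersimplex, whose
   vertices are the indicators of k-sets, so by convexity the unthresholded tail
   A ((u^p - x_S) w^p) is no larger than A applied to a k-sparse restriction of u^p - x_S;
   comparing w^p with the indicator of S bounds the residual. *)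

Require Import Defs.
From HB Require Import structures.
From mathcomp Require Import all_boot all_order all_algebra.
From mathcomp Require Import all_classical all_reals all_analysis.
From mathcomp Require Import ring lra.
Import Order.TTheory GRing.Theory Num.Theory.
Import numFieldNormedType.Exports.
Local Open Scope classical_set_scope.
Local Open Scope ring_scope.

Set Implicit Arguments.
Unset Strict Implicit.

(** * Inner product, Euclidean norm and Cauchy-Schwarz *)

Definition dot {R : realType} {n : nat} (u v : 'cV[R]_n) : R := (u^T *m v) 0 0.

Section Dot.
Context {R : realType}.

Lemma dotE n (u v : 'cV[R]_n) : dot u v = \sum_i u i 0 * v i 0.
Proof. by rewrite /dot mxE; apply: eq_bigr => i _; rewrite mxE. Qed.

Lemma dotC n (u v : 'cV[R]_n) : dot u v = dot v u.
Proof. by rewrite !dotE; apply: eq_bigr => i _; rewrite mulrC. Qed.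

Lemma dotDl n (u v w : 'cV[R]_n) : dot (u + v) w = dot u w + dot v w.
Proof. by rewrite /dot linearD /= mulmxDl mxE. Qed.

Lemma dotNl n (u w : 'cV[R]_n) : dot (- u) w = - dot u w.
Proof. by rewrite /dot linearN /= mulNmx mxE. Qed.

Lemma dotZl n a (u w : 'cV[R]_n) : dot (a *: u) w = a * dot u w.
Proof. by rewrite /dot linearZ /= -scalemxAl mxE. Qed.

Lemma dotDr n (u v w : 'cV[R]_n) : dot w (u + v) = dot w u + dot w v.
Proof. by rewrite dotC dotDl !(dotC w). Qed.

Lemma dotNr n (u w : 'cV[R]_n) : dot w (- u) = - dot w u.
Proof. by rewrite dotC dotNl !(dotC w). Qed.

Lemma dotZr n a (u w : 'cV[R]_n) : dot w (a *: u) = a * dot w u.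
Proof. by rewrite dotC dotZl !(dotC w). Qed.

Definition dot_lin := (dotDl, dotDr, dotNl, dotNr, dotZl, dotZr).

Lemma dot_mulmxl m n (A : 'M[R]_(m, n)) u v : dot (A *m u) v = dot u (A^T *m v).
Proof. by rewrite /dot trmx_mul mulmxA. Qed.

Lemma dot_ge0 n (u : 'cV[R]_n) : 0 <= dot u u.
Proof. by rewrite dotE sumr_ge0 // => i _; rewrite -expr2 sqr_ge0. Qed.

Lemma dot_eq0 n (u : 'cV[R]_n) : (dot u u == 0) = (u == 0).
Proof.
apply/idP/eqP => [|->]; last by rewrite /dot mulmx0 mxE.
rewrite dotE psumr_eq0 => [/allP u0|i _]; last by rewrite -expr2 sqr_ge0.
apply/colP => i; have := u0 i (mem_index_enum _).
by rewrite mxE -expr2 sqrf_eq0 => /eqP.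
Qed.

Lemma dot_gt0 n (u : 'cV[R]_n) : (0 < dot u u) = (u != 0).
Proof. by rewrite lt_def dot_eq0 dot_ge0 andbT. Qed.

Lemma norm2E n (u : 'cV[R]_n) : norm2 u = Num.sqrt (dot u u).
Proof. by rewrite /norm2 dotE; congr Num.sqrt; apply: eq_bigr => i _; rewrite expr2. Qed.

Lemma norm2_ge0 n (u : 'cV[R]_n) : 0 <= norm2 u.
Proof. exact: sqrtr_ge0. Qed.

Lemma norm2_sqr n (u : 'cV[R]_n) : norm2 u ^+ 2 = dot u u.
Proof. by rewrite norm2E sqr_sqrtr ?dot_ge0. Qed.

Lemma norm2_le n (u : 'cV[R]_n) b : 0 <= b -> dot u u <= b ^+ 2 -> norm2 u <= b.
Proof. by move=> b0; rewrite -norm2_sqr ler_pXn2r ?nnegrE ?norm2_ge0. Qed.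

Lemma norm2_mono m n (u : 'cV[R]_n) (v : 'cV[R]_m) :
  dot u u <= dot v v -> norm2 u <= norm2 v.
Proof. by rewrite -(norm2_sqr v); apply: norm2_le; exact: norm2_ge0. Qed.

Lemma norm2_0 n : norm2 (0 : 'cV[R]_n) = 0.
Proof. by rewrite norm2E /dot mulmx0 mxE sqrtr0. Qed.

Lemma norm2N n (u : 'cV[R]_n) : norm2 (- u) = norm2 u.
Proof. by rewrite !norm2E !dot_lin opprK. Qed.

Lemma norm2Z n a (u : 'cV[R]_n) : 0 <= a -> norm2 (a *: u) = a * norm2 u.
Proof.
by move=> a0; rewrite !norm2E !dot_lin mulrA -expr2 sqrtrM ?sqr_ge0 // sqrtr_sqr ger0_norm.
Qed.

(** Cauchy-Schwarz: expand the square of [norm2 v *: u - norm2 u *: v] and divide by the product of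
    the norms, which is why zero vectors are treated apart. *)
Lemma dot_le_norm2 n (u v : 'cV[R]_n) : dot u v <= norm2 u * norm2 v.
Proof.
have [->|v0] := eqVneq v 0; first by rewrite norm2_0 mulr0 /dot mulmx0 mxE.
have vv : 0 < dot v v by rewrite dot_gt0.
have nv : 0 < norm2 v by rewrite norm2E sqrtr_gt0.
have := dot_ge0 (norm2 v *: u - norm2 u *: v); rewrite !dot_lin -!norm2_sqr (dotC v u).
have := norm2_ge0 u; rewrite le_eqVlt => /orP[/eqP u0 _|nu].
  have : norm2 u == 0 by rewrite -u0.
  rewrite norm2E sqrtr_eq0 le_eqVlt ltNge dot_ge0 orbF dot_eq0 => /eqP ->.
  by rewrite /dot linear0 mul0mx mxE mulr_ge0 ?norm2_ge0.
move=> h; rewrite -(ler_pM2l (mulr_gt0 nu nv)); nra.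
Qed.

Lemma norm2D n (u v : 'cV[R]_n) : norm2 (u + v) <= norm2 u + norm2 v.
Proof.
apply: norm2_le; first by rewrite addr_ge0 ?norm2_ge0.
rewrite !dot_lin -!norm2_sqr (dotC v u); have := dot_le_norm2 u v; nra.
Qed.

Lemma norm2B n (u v : 'cV[R]_n) : norm2 (u - v) <= norm2 u + norm2 v.
Proof. by rewrite -(norm2N v) norm2D. Qed.

Lemma norm2_mulmx_bound m n (A : 'M[R]_(m, n)) :
  exists2 c, 0 <= c & forall u, dot (A *m u) (A *m u) <= c * dot u u.
Proof.
(* The squared Frobenius norm; Cauchy-Schwarz bounds each entry of [A *m u]. *)
exists (\sum_i norm2 (row i A)^T ^+ 2) => [|u].
  by apply: sumr_ge0 => i _; rewrite sqr_ge0.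
rewrite dotE mulr_suml; apply: ler_sum => i _.
have E : (A *m u) i 0 = dot (row i A)^T u.
  by rewrite /dot trmxK -row_mul [in RHS]mxE.
rewrite E -(norm2_sqr u) -expr2 -exprMn -(real_normK (num_real (dot _ _))).
rewrite ler_pXn2r ?nnegrE ?normr_ge0 ?mulr_ge0 ?norm2_ge0 //.
by rewrite ler_norml dot_le_norm2 andbT lerNl -dotNl -(norm2N (_^T)) dot_le_norm2 .
Qed.

End Dot.

(** * Positive semidefinite forms and the largest eigenvalue of a symmetric matrix *)

Section Spectral.
Context {R : realType}.

(** Positivity of the form at [v - t *: M v] gives a quadratic inequality in t; t = 1/c is optimal,
    and t = 1 settles c = 0. Spectrally, s^2 <= c s on [0, c]. *)
Lemma psd_norm n (M : 'M[R]_n) c : M^T = M -> 0 <= c ->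
  (forall v, 0 <= dot (M *m v) v <= c * dot v v) ->
  forall v, dot (M *m v) (M *m v) <= c * dot (M *m v) v.
Proof.
move=> sM c0 MP v; set a := M *m v.
have P t : 0 <= dot a v - 2 * t * dot a a + t ^+ 2 * (c * dot a a).
  have /andP[+ _] := MP (v - t *: a).
  rewrite mulmxBr -scalemxAr -/a !dot_lin.
  have -> : dot (M *m a) v = dot a a by rewrite dot_mulmxl sM.
  have /andP[_ /(ler_wpM2l (sqr_ge0 t))] := MP a; lra.
have [c1|c1] := ltP 0 c.
  have := P c^-1; rewrite -(ler_pM2l c1) mulr0.
  have -> : c * (dot a v - 2 * c^-1 * dot a a + c^-1 ^+ 2 * (c * dot a a))
    = c * dot a v - dot a a by field; rewrite gt_eqF.
  by rewrite subr_ge0.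
have c00 : c = 0 by apply/eqP; rewrite eq_le c1 c0.
have /andP[_] := MP v; rewrite c00 -/a => h1.
by have := P 1; rewrite c00; lra.
Qed.

Lemma psd_norm2 n (M : 'M[R]_n) c : M^T = M -> 0 <= c ->
  (forall v, 0 <= dot (M *m v) v <= c * dot v v) ->
  forall v, norm2 (M *m v) <= c * norm2 v.
Proof.
move=> sM c0 MP v; apply: norm2_le; first by rewrite mulr_ge0 ?norm2_ge0.
apply: le_trans (psd_norm sM c0 MP v) _.
by rewrite exprMn norm2_sqr expr2 -mulrA ler_wpM2l //; have /andP[] := MP v.
Qed.

Lemma unitmx_bounded_below n (M : 'M[R]_n) : M \in unitmx ->
  exists2 c, 0 < c & forall v, dot v v <= c * dot (M *m v) (M *m v).
Proof.
move=> uM; have [c c0 h] := norm2_mulmx_bound (invmx M).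
exists (c + 1) => [|v]; first lra.
by have := h (M *m v); rewrite mulKmx //; have := dot_ge0 (M *m v); nra.
Qed.

(* With t the supremum of the Rayleigh quotient, if t%:M - G were invertible it would be
   bounded below, so t could be decreased. *)
Lemma max_eigenvalue n (G : 'M[R]_n) : (0 < n)%N -> G^T = G ->
  exists2 t, eigenvalue G t & forall v, dot (G *m v) v <= t * dot v v.
Proof.
move=> n0 sG; have [c c0 Gc] := norm2_mulmx_bound G.
(* From the squares of [G *m v + v] and [G *m v - v]; it makes [E] nonempty. *)
have Gc1 v : `|dot (G *m v) v| <= (c + 1) * dot v v.
  have := Gc v; have := dot_ge0 (G *m v - v); have := dot_ge0 (G *m v + v).
  rewrite !dot_lin (dotC v) => h1 h2 h3; have h4 := dot_ge0 v.
  by rewrite ler_norml; apply/andP; split; nra.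
pose E := [set t : R | forall v, dot (G *m v) v <= t * dot v v].
pose e := delta_mx (Ordinal n0) 0 : 'cV[R]_n.
have e1 : dot e e = 1.
  rewrite dotE (bigD1 (Ordinal n0)) //= big1 ?addr0 => [|i ni].
    by rewrite !mxE !eqxx mulr1.
  by rewrite !mxE (negPf ni) mul0r.
have E0 : E !=set0 by exists (c + 1) => v; apply: le_trans (ler_norm _) (Gc1 v).
have lbE : has_lbound E by exists (dot (G *m e) e) => t /(_ e); rewrite e1 mulr1.
(* The Rayleigh quotient of each nonzero [v] is a lower bound of [E], so the infimum belongs to
   [E]. *)
have Einf : E (inf E).
  move=> v; have [->|v0] := eqVneq v 0; first by rewrite mulmx0 /dot !mulmx0 mxE mulr0.
  have vv : 0 < dot v v by rewrite dot_gt0.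
  rewrite -ler_pdivrMr //; apply: lb_le_inf => // t tE.
  by rewrite ler_pdivrMr.
exists (inf E) => //; set t := inf E in Einf *.
apply: contraT => nt.
pose M := t%:M - G.
have MvE v : M *m v = t *: v - G *m v by rewrite mulmxBl mul_scalar_mx.
have uM : M \in unitmx.
  have -> : M = (-1) *: (G - t%:M) by rewrite scaleN1r opprB.
  rewrite unitmxZ ?unitrN1 // -row_free_unit -kermx_eq0.
  by move: nt; rewrite /eigenvalue negbK.
have sM : M^T = M by rewrite linearB /= tr_scalar_mx sG.
have [c' c'0 Mc] := norm2_mulmx_bound M.
have Mnn v : 0 <= dot (M *m v) v.
  by have := Einf v; rewrite MvE !dot_lin subr_ge0.
have Mb v : 0 <= dot (M *m v) v <= (c' + 1) * dot v v.
  rewrite Mnn /=; have := Mc v; have := dot_ge0 (M *m v - v).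
  rewrite !dot_lin (dotC v) => h1 h2; have := dot_ge0 v.
  by have := Mnn v; nra.
have c'1 : 0 <= c' + 1 by lra.
have [b b0 Hb] := unitmx_bounded_below uM.
(* Combine |v|^2 <= b |M v|^2 with |M v|^2 <= (c' + 1) <M v, v>, the latter by [psd_norm]. *)
have : E (t - (b * (c' + 1))^-1).
  move=> v; have h := psd_norm sM c'1 Mb v.
  have h1 := Hb v; have bc : 0 < b * (c' + 1) by nra.
  have : (b * (c' + 1))^-1 * dot v v <= dot (M *m v) v.
    by rewrite mulrC ler_pdivrMr //; nra.
  by rewrite MvE !dot_lin; lra.
move=> /(ge_inf lbE); rewrite -/t lerBrDr gerDl leNgt invr_gt0.
by rewrite mulr_gt0 //; lra.
Qed.

End Spectral.

(** * Spectral bounds for the Newton correction and for the noise term *)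

Section Newton.
Context {R : realType}.

Lemma posdef_unitmx n (M : 'M[R]_n) :
  (forall v, v != 0 -> 0 < dot (M *m v) v) -> M \in unitmx.
Proof.
move=> MP; rewrite -row_free_unit -kermx_eq0; apply/rowV0P => u /sub_kermxP uM.
apply: trmx_inj; rewrite trmx0; apply/eqP; apply: contraT => /MP.
by rewrite dotC /dot trmxK mulmxA uM mul0mx mxE ltxx.
Qed.

Variables (m n : nat) (A : 'M[R]_(m, n)).
Let G := A *m A^T.

Lemma dot_gram v : dot (G *m v) v = dot (A^T *m v) (A^T *m v).
Proof. by rewrite /G -mulmxA dot_mulmxl. Qed.

Lemma gram_sym : G^T = G.
Proof. by rewrite /G trmx_mul trmxK. Qed.

Lemma eigenvalueN p (M : 'M[R]_p) t : eigenvalue (- M) t = eigenvalue M (- t).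
Proof.
apply/eigenvalueP/eigenvalueP => -[v Mv v0]; exists v => //.
  by rewrite scaleNr -Mv mulmxN opprK.
by rewrite mulmxN Mv scaleNr opprK.
Qed.

Lemma eigenvalue_gram_singular t :
  eigenvalue G t -> 0 <= t /\ is_singular_value A (Num.sqrt t).
Proof.
move=> Gt; have t0 : 0 <= t.
  have /eigenvalueP[v Gv v0] := Gt.
  have vv : 0 < dot v^T v^T.
    by rewrite dot_gt0; apply: contraNneq v0 => /(congr1 trmx); rewrite trmxK trmx0 => ->.
  have := dot_ge0 (A^T *m v^T); rewrite -dot_gram dotC /dot trmxK mulmxA Gv -scalemxAl mxE.
  by move: vv; rewrite /dot trmxK => vv; rewrite pmulr_lge0.
by split=> //; split; rewrite ?sqrtr_ge0 // sqr_sqrtr.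
Qed.

Lemma gram_le s1 : (0 < m)%N ->
  (forall s, is_singular_value A s -> s <= s1) ->
  forall v, dot (A^T *m v) (A^T *m v) <= s1 ^+ 2 * dot v v.
Proof.
move=> m0 smax v; have [t /eigenvalue_gram_singular[t0 /smax ts] tG] := max_eigenvalue m0 gram_sym.
rewrite -dot_gram (le_trans (tG v)) // ler_wpM2r ?dot_ge0 //.
by rewrite -(sqr_sqrtr t0) ler_pXn2r ?nnegrE ?sqrtr_ge0 // (le_trans _ ts) ?sqrtr_ge0.
Qed.

(** The least eigenvalue of [G] is the opposite of the greatest eigenvalue of [- G]. *)
Lemma gram_ge sm : (0 < m)%N -> 0 <= sm ->
  (forall s, is_singular_value A s -> sm <= s) ->
  forall v, sm ^+ 2 * dot v v <= dot (A^T *m v) (A^T *m v).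
Proof.
move=> m0 sm0 smin v.
have NGs : (- G)^T = - G by rewrite linearN /= gram_sym.
have [t] := max_eigenvalue m0 NGs.
rewrite eigenvalueN => /eigenvalue_gram_singular[t0 /smin ts] /(_ v).
rewrite mulNmx dotNl dot_gram => tG.
have : sm ^+ 2 <= - t.
  by rewrite -(sqr_sqrtr t0) ler_pXn2r ?nnegrE ?sqrtr_ge0.
by have := dot_ge0 v; nra.
Qed.

Variables (s1 sm eps lam : R).
Hypotheses (s1_ge0 : 0 <= s1) (eps_gt0 : 0 < eps) (s1_eps : s1 ^+ 2 <= eps)
  (lam_ge0 : 0 <= lam) (lam_le : lam <= eps + sm ^+ 2) (sm_s1 : sm ^+ 2 <= s1 ^+ 2)
  (Gle : forall v, dot (A^T *m v) (A^T *m v) <= s1 ^+ 2 * dot v v)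
  (Gge : forall v, sm ^+ 2 * dot v v <= dot (A^T *m v) (A^T *m v)).

Let K := invmx (G + eps%:M).

Lemma shifted_gram_unitmx p q (B : 'M[R]_(p, q)) : B *m B^T + eps%:M \in unitmx.
Proof.
apply: posdef_unitmx => v v0.
rewrite mulmxDl mul_scalar_mx !dot_lin -mulmxA dot_mulmxl.
by rewrite ltr_wpDl ?dot_ge0 // mulr_gt0 ?dot_gt0.
Qed.

(** Both shifted Gram matrices are invertible and (A^T A + eps) A^T = A^T (G + eps). The resolvent
    thus moves to the m-dimensional side, where the spectrum is bounded below by sm^2. *)
Lemma invmx_shifted_gram : invmx (A^T *m A + eps%:M) *m A^T = A^T *m K.
Proof.
have U : A^T *m A + eps%:M \in unitmx.
  by have := shifted_gram_unitmx A^T; rewrite trmxK.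
apply: (can_inj (mulKmx U)); rewrite mulKVmx // mulmxA.
have -> : (A^T *m A + eps%:M) *m A^T = A^T *m (G + eps%:M).
  by rewrite mulmxDl mulmxDr mulmxA mul_scalar_mx mul_mx_scalar.
by rewrite mulmxK // shifted_gram_unitmx.
Qed.

Lemma resolventE (v : 'cV[R]_m) : v = G *m (K *m v) + eps *: (K *m v).
Proof. by rewrite -mul_scalar_mx -mulmxDl mulKVmx // shifted_gram_unitmx. Qed.

Lemma resolvent_sym : K^T = K.
Proof. by rewrite /K trmx_inv linearD /= gram_sym tr_scalar_mx. Qed.

(** [A] inherits the norm bound of its transpose: |A h|^2 = <h, A^T A h> <= |h| s1 |A h|, then
    cancel |A h|. *)
Lemma mulmx_le h : dot (A *m h) (A *m h) <= s1 ^+ 2 * dot h h.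
Proof.
have : dot (A *m h) (A *m h) <= norm2 h * norm2 (A^T *m (A *m h)).
  by rewrite dot_mulmxl dot_le_norm2.
have : norm2 (A^T *m (A *m h)) <= s1 * norm2 (A *m h).
  by apply: norm2_le; rewrite ?mulr_ge0 ?norm2_ge0 // exprMn norm2_sqr.
rewrite -!norm2_sqr -exprMn; have := norm2_ge0 (A *m h); have := norm2_ge0 h.
set a := norm2 (A *m h); set b := norm2 h => b0 a0 h1 h2.
have [->|an0] := eqVneq a 0; first by rewrite expr0n /= sqr_ge0.
have : a <= s1 * b.
  by rewrite -(ler_pM2r (x := a)) ?lt_def ?an0 // -expr2; nra.
by move=> h3; rewrite ler_pXn2r ?nnegrE ?mulr_ge0.
Qed.

Lemma gram_norm2 v : dot (G *m v) (G *m v) <= s1 ^+ 2 * dot (G *m v) v.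
Proof.
apply: psd_norm (gram_sym) (sqr_ge0 _) _ v => v.
by rewrite dot_gram dot_ge0 Gle.
Qed.

(** The value at s = s1^2 of s - lam s / (eps + s), the spectral function of the Newton correction,
    which increases on [sm^2, s1^2] because lam <= eps + sm^2. *)
Let c := s1 ^+ 2 - lam * s1 ^+ 2 / (eps + s1 ^+ 2).

Lemma newton_coef_ge0 : 0 <= c.
Proof.
have E1 : 0 < eps + s1 ^+ 2 by rewrite ltr_pwDl ?sqr_ge0.
rewrite /c subr_ge0 mulrAC ler_piMl ?sqr_ge0 // ler_pdivrMr // mul1r.
by rewrite (le_trans lam_le) // lerD2l.
Qed.

(** The operator is A^T (1 - lam K) A. With a = A h and b = K a, so that a = (G + eps) b, its form
    at h is <a, a> - lam <b, a>, which is quadratic in b with coefficients polynomial in [G]. *)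
Lemma newton_quad h :
  let M := A^T *m A - lam *: (invmx (A^T *m A + eps%:M) *m (A^T *m A)) in
  M^T = M /\ 0 <= dot (M *m h) h <= c * dot h h.
Proof.
move=> M.
have ME : M = A^T *m (1%:M - lam *: K) *m A.
  rewrite /M mulmxA invmx_shifted_gram mulmxBr mulmx1 mulmxBl.
  by rewrite -scalemxAr -scalemxAl.
split.
  by rewrite ME !trmx_mul trmxK linearB linearZ /= tr_scalar_mx resolvent_sym mulmxA.
rewrite ME -!mulmxA dot_mulmxl trmxK mulmxBl mul1mx -scalemxAl.
set a := A *m h; set b := K *m a.
have E1 : 0 < eps + s1 ^+ 2 by rewrite ltr_pwDl ?sqr_ge0.
have aE : a = G *m b + eps *: b by rewrite {1}(resolventE a).
have H1 := dot_gram b; have H2 := gram_norm2 b.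
have H3 := Gle b; have H4 := Gge b; rewrite -H1 in H3 H4.
have H5 := dot_ge0 b.
have H6 := dot_ge0 (G *m b - sm ^+ 2 *: b).
rewrite !dot_lin (dotC b (G *m b)) in H6.
have aa : dot a a = dot (G *m b) (G *m b) + 2 * eps * dot (G *m b) b + eps ^+ 2 * dot b b.
  by rewrite aE !dot_lin (dotC b (G *m b)); ring.
have ba : dot b a = dot (G *m b) b + eps * dot b b.
  by rewrite aE !dot_lin (dotC b (G *m b)).
rewrite !dot_lin.
apply/andP; split.
  (* Spectrally, (s + eps)(s + eps - lam) is the sum of (s - sm^2)^2, (eps + sm^2)(s - sm^2) and
     (eps + sm^2 - lam)(s + eps), which are [H6], [H7] and [H8]. *)
  have H7 : 0 <= (eps + sm ^+ 2) * (dot (G *m b) b - sm ^+ 2 * dot b b).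
    by rewrite mulr_ge0 ?subr_ge0 // addr_ge0 ?sqr_ge0 // ltW.
  have H8 : 0 <= (eps + sm ^+ 2 - lam) * (dot (G *m b) b + eps * dot b b).
    by rewrite mulr_ge0 ?subr_ge0 // H1 addr_ge0 ?dot_ge0 // mulr_ge0 // ltW.
  rewrite aa ba; lra.
(* Since <b, a> is at least <a, a> / (eps + s1^2), the form is at most (1 - q) <a, a> with q = lam /
   (eps + s1^2) <= 1; then [mulmx_le] applies. *)
have ab : dot a a <= (eps + s1 ^+ 2) * dot b a.
  by have := ler_wpM2l (ltW eps_gt0) H3; rewrite aa ba; lra.
have : dot a a <= s1 ^+ 2 * dot h h by exact: mulmx_le.
rewrite /c => ah.
have l1 : lam / (eps + s1 ^+ 2) <= 1.
  by rewrite ler_pdivrMr // mul1r (le_trans lam_le) // lerD2l.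
have : dot a a / (eps + s1 ^+ 2) <= dot b a by rewrite ler_pdivrMr // mulrC.
move=> ab'; have l0 : 0 <= lam / (eps + s1 ^+ 2) by rewrite divr_ge0 // ltW.
have := ler_wpM2l lam_ge0 ab'.
rewrite mulrA (mulrAC lam); set q := lam / _ in l1 l0 *.
rewrite [lam * _ / _]mulrAC -/q; nra.
Qed.

Lemma newton_contraction h :
  norm2 (A^T *m (A *m h)
         - lam *: (invmx (A^T *m A + eps%:M) *m (A^T *m (A *m h)))) <= c * norm2 h.
Proof.
have [sM _] := newton_quad 0; rewrite /= in sM.
have := psd_norm2 sM newton_coef_ge0 (fun v => (newton_quad v).2) h.
by rewrite mulmxBl -scalemxAl -!mulmxA.
Qed.

(** The singular values of A^T K are sqrt(s) / (eps + s), which increases for s <= eps; as s1^2 <=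
    eps, the bound is its value at s1^2. *)
Lemma newton_noise v :
  norm2 (lam *: (invmx (A^T *m A + eps%:M) *m (A^T *m v)))
    <= lam * s1 / (eps + s1 ^+ 2) * norm2 v.
Proof.
have E1 : 0 < eps + s1 ^+ 2 by rewrite ltr_pwDl ?sqr_ge0.
rewrite mulmxA invmx_shifted_gram -mulmxA norm2Z // -!mulrA ler_wpM2l //.
apply: norm2_le.
  by rewrite !mulr_ge0 ?invr_ge0 ?norm2_ge0 // ltW.
set b := K *m v.
have vE : v = G *m b + eps *: b by rewrite {1}(resolventE v).
have H1 := dot_gram b; have H3 := Gle b; rewrite -H1 in H3.
have vv : dot v v = dot (G *m b) (G *m b) + 2 * eps * dot (G *m b) b + eps ^+ 2 * dot b b.
  by rewrite vE !dot_lin (dotC b (G *m b)); ring.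
rewrite -H1 !exprMn norm2_sqr mulrCA exprVn mulrC ler_pdivlMr ?exprn_gt0 // vv.
(* The difference of the two sides is, spectrally, (s1^2 - s) (eps^2 - s1^2 s). *)
have H6 := dot_ge0 (G *m b - s1 ^+ 2 *: b).
rewrite !dot_lin (dotC b (G *m b)) in H6.
(* Split the second factor as (eps^2 - s1^4) + s1^2 (s1^2 - s): the first summand gives [H7], the
   second s1^2 times [H6]. *)
have H7 : 0 <= (eps ^+ 2 - s1 ^+ 2 ^+ 2) * (s1 ^+ 2 * dot b b - dot (G *m b) b).
  by rewrite mulr_ge0 ?subr_ge0 // ler_pXn2r ?nnegrE ?sqr_ge0 // ltW.
by have := ler_wpM2l (sqr_ge0 s1) H6; lra.
Qed.

End Newton.

(** * Restriction of vectors to index sets *)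

Section Restrict.
Context {R : realType} {n : nat}.
Implicit Types (u v : 'cV[R]_n) (S T : {set 'I_n}).

Lemma restrictB S u v : restrict_idx S (u - v) = restrict_idx S u - restrict_idx S v.
Proof. by apply/colP => i; rewrite !mxE; case: ifP; rewrite ?subr0. Qed.

Lemma restrict_restrict S T u :
  restrict_idx S (restrict_idx T u) = restrict_idx (S :&: T) u.
Proof. by apply/colP => i; rewrite !mxE inE; case: (i \in S). Qed.

Lemma restrict_setT u : restrict_idx [set: 'I_n]%SET u = u.
Proof. by apply/colP => i; rewrite mxE inE. Qed.

Lemma supp_restrict S u : supp (restrict_idx S u) \subset S.
Proof. by apply/fintype.subsetP => i; rewrite inE mxE; case: ifP => //; rewrite eqxx. Qed.

Lemma restrict_supp S u : supp u \subset S -> restrict_idx S u = u.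
Proof.
move=> /fintype.subsetP uS; apply/colP => i; rewrite mxE; case: ifPn => // iS.
by apply/esym/eqP; apply: contraNT iS => ui; apply: uS; rewrite inE.
Qed.

Lemma sparse_restrict k S u : (#|S| <= k)%N -> sparse k (restrict_idx S u).
Proof. by move=> Sk; apply: leq_trans Sk; exact: subset_leq_card (supp_restrict _ _). Qed.

Lemma dot_restrict S u v : dot (restrict_idx S u) v = \sum_(i in S) u i 0 * v i 0.
Proof.
rewrite dotE [RHS]big_mkcond; apply: eq_bigr => i _; rewrite mxE.
by case: ifP; rewrite ?mul0r.
Qed.

Lemma restrict_adj S u v : dot (restrict_idx S u) v = dot u (restrict_idx S v).
Proof. by rewrite dot_restrict dotC dot_restrict; apply: eq_bigr => i _; rewrite mulrC. Qed.

Lemma norm2_restrictE S u : norm2 (restrict_idx S u) ^+ 2 = \sum_(i in S) (u i 0) ^+ 2.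
Proof.
rewrite norm2_sqr dot_restrict; apply: eq_bigr => i iS.
by rewrite mxE iS expr2.
Qed.

Lemma norm2_restrict_sub S T u : S \subset T ->
  norm2 (restrict_idx S u) <= norm2 (restrict_idx T u).
Proof.
move=> ST; rewrite -(ler_pXn2r (n := 2)) ?nnegrE ?norm2_ge0 // !norm2_restrictE.
rewrite [leRHS](big_setID S) /= (finset.setIidPr ST) lerDl.
by apply: sumr_ge0 => i _; rewrite sqr_ge0.
Qed.

Lemma norm2_restrict_le S u : norm2 (restrict_idx S u) <= norm2 u.
Proof. by rewrite -[X in _ <= norm2 X]restrict_setT norm2_restrict_sub ?finset.subsetT. Qed.

End Restrict.

(** * Restricted isometry constants *)

Section RIP.
Context {R : realType} {m n : nat}.
Variable A : 'M[R]_(m, n).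

Let ric_set q := [set d : R | 0 <= d /\
  forall z : 'cV[R]_n, sparse q z ->
    (1 - d) * norm2 z ^+ 2 <= norm2 (A *m z) ^+ 2 /\
    norm2 (A *m z) ^+ 2 <= (1 + d) * norm2 z ^+ 2].

Let ric_set_nonempty q : ric_set q !=set0.
Proof.
have [c c0 Ac] := norm2_mulmx_bound A; exists (c + 1); split; first lra.
move=> z _; rewrite !norm2_sqr; have := Ac z.
by have := dot_ge0 (A *m z); have := dot_ge0 z; split; nra.
Qed.

Let ric_set_lbound q : has_lbound (ric_set q).
Proof. by exists 0 => d []. Qed.

Lemma ric_ge0 q : 0 <= ric A q.
Proof. by apply: lb_le_inf => [|d []]; first exact: ric_set_nonempty. Qed.

Lemma ric_mono p q : (p <= q)%N -> ric A p <= ric A q.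
Proof.
move=> pq; apply: lb_le_inf => [|d [d0 dq]]; first exact: ric_set_nonempty.
apply: ge_inf; first exact: ric_set_lbound.
by split=> // z zp; apply: dq; exact: leq_trans pq.
Qed.

(** The infimum in [ric] is attained: for fixed nonzero [z], the deviation of |A z|^2 / |z|^2 from 1
    is a lower bound of the admissible constants. *)
Lemma ricP q (z : 'cV[R]_n) : sparse q z ->
  (1 - ric A q) * norm2 z ^+ 2 <= norm2 (A *m z) ^+ 2 <= (1 + ric A q) * norm2 z ^+ 2.
Proof.
move=> zq; have [->|z0] := eqVneq z 0.
  by rewrite mulmx0 !norm2_0 expr0n /= !mulr0 lexx.
have zz : 0 < norm2 z ^+ 2 by rewrite norm2_sqr dot_gt0.
suff : `|norm2 (A *m z) ^+ 2 / norm2 z ^+ 2 - 1| <= ric A q.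
  rewrite ler_norml => /andP[h1 h2]; apply/andP; split.
    by rewrite -ler_pdivlMr //; lra.
  by rewrite -ler_pdivrMr //; lra.
apply: lb_le_inf; first exact: ric_set_nonempty.
move=> d [d0 /(_ z zq)[h1 h2]].
rewrite -ler_pdivlMr // in h1; rewrite -ler_pdivrMr // in h2.
by rewrite ler_norml; apply/andP; split; lra.
Qed.

(** Polarization: with [g] the left-hand vector, |g|^2 = <h, g> - <A h, A g>, and both h + t g and h
    - t g are q-sparse, so subtracting their isometry inequalities bounds this quantity. *)
Lemma rip_residual q (h : 'cV[R]_n) (Om : {set 'I_n}) : (#|Om :|: supp h| <= q)%N ->
  norm2 (restrict_idx Om (h - A^T *m (A *m h))) <= ric A q * norm2 h.
Proof.
move=> Omq; set g := restrict_idx Om _.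
have gg : dot g g = dot h g - dot (A *m h) (A *m g).
  rewrite {1}/g restrict_adj /g restrict_restrict finset.setIid -/g.
  by rewrite !dot_lin (dotC (A^T *m _)) -dot_mulmxl (dotC (A *m g)).
have sp t : sparse q (h + t *: g).
  apply: leq_trans Omq; apply: subset_leq_card; apply/fintype.subsetP => i.
  rewrite !inE !mxE; apply: contraNT; rewrite negb_or negbK => /andP[/negPf -> /eqP ->].
  by rewrite mulr0 addr0.
have key t : 2 * t * dot g g <= ric A q * (dot h h + t ^+ 2 * dot g g).
  have /andP[_ h2] := ricP (sp (- t)); have /andP[h1 _] := ricP (sp t).
  move: h1 h2; rewrite !norm2_sqr !mulmxDr -!scalemxAr !dot_lin gg.
  by rewrite (dotC g h) (dotC (A *m g) (A *m h)); lra.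
have := norm2_ge0 g; rewrite le_eqVlt => /orP[/eqP <-|g0].
  by rewrite mulr_ge0 ?ric_ge0 ?norm2_ge0.
(* This t makes the two terms |h|^2 and t^2 |g|^2 equal. *)
have := key (norm2 h / norm2 g); rewrite -!norm2_sqr.
have -> : 2 * (norm2 h / norm2 g) * norm2 g ^+ 2 = 2 * (norm2 h * norm2 g).
  by field; rewrite gt_eqF.
have -> : norm2 h ^+ 2 + (norm2 h / norm2 g) ^+ 2 * norm2 g ^+ 2 = 2 * norm2 h ^+ 2.
  by field; rewrite gt_eqF.
have := norm2_ge0 h; rewrite le_eqVlt => /orP[/eqP h0 _|h0 hh].
  suff: g = 0 by move=> ->; rewrite norm2_0 -h0 mulr0.
  have : h = 0 by apply/eqP; rewrite -dot_eq0 -norm2_sqr -h0 expr0n.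
  by rewrite /g => ->; rewrite !mulmx0 subrr; apply/colP => i; rewrite !mxE; case: ifP.
by rewrite -(ler_pM2l h0); lra.
Qed.

End RIP.

(** * Quasiconvex maximization over the hypersimplex *)

Section Hypersimplex.
Context {R : realType} {n : nat}.
Implicit Types w : 'cV[R]_n.

Definition frac w : {set 'I_n} := [set i | 0 < w i 0 < 1].

Lemma feasible_integral k w i : feasible_w k w -> i \notin frac w ->
  w i 0 = (w i 0 == 1)%:R.
Proof.
move=> [_ /(_ i)/andP[w0 w1]]; rewrite inE negb_and -!leNgt.
case: eqVneq => // wi /orP[wi0|w1']; first by apply/eqP; rewrite eq_le w0 wi0.
by move/eqP: wi; case; apply/eqP; rewrite eq_le w1 w1'.
Qed.

(** Mass moves from entry [j] to entry [i] until [w i 0] reaches 1 or [w j 0] reaches 0, so a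
    fractional entry disappears. *)
Lemma feasible_push k w i j : feasible_w k w -> i != j -> i \in frac w -> j \in frac w ->
  exists2 b, 0 < b & let w' := w + b *: (delta_mx i 0 - delta_mx j 0) in
    feasible_w k w' /\ (#|frac w'| < #|frac w|)%N.
Proof.
move=> [sw w01] ij iw jw.
have := iw; have := jw; rewrite !inE => /andP[wj0 wj1] /andP[wi0 wi1].
set b := Num.min (1 - w i 0) (w j 0).
have b0 : 0 < b by rewrite lt_min wj0 subr_gt0 wi1.
have bi : b <= 1 - w i 0 by rewrite ge_min lexx.
have bj : b <= w j 0 by rewrite ge_min lexx orbT.
exists b => // w'.
have w'E l : w' l 0 = w l 0 + b * ((l == i)%:R - (l == j)%:R).
  by rewrite !mxE eqxx !andbT.
have w'i : w' i 0 = w i 0 + b by rewrite w'E eqxx (negPf ij) subr0 mulr1.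
have w'j : w' j 0 = w j 0 - b.
  by rewrite w'E eqxx eq_sym (negPf ij) sub0r mulrN1.
have w'l l : l != i -> l != j -> w' l 0 = w l 0.
  by move=> /negPf li /negPf lj; rewrite w'E li lj subrr mulr0 addr0.
split; first split.
- rewrite -sw (eq_bigr _ (fun l _ => w'E l)) big_split /= -mulr_sumr sumrB.
  have S1 l0 : \sum_l (l == l0 :> 'I_n)%:R = 1 :> R.
    by rewrite (bigD1 l0) //= eqxx big1 ?addr0 // => l /negPf ->.
  by rewrite !S1 subrr mulr0 addr0.
- move=> l; have [->|li] := eqVneq l i; first by rewrite w'i; apply/andP; split; lra.
  have [->|lj] := eqVneq l j; first by rewrite w'j; apply/andP; split; lra.
  by rewrite w'l.
have fr l : l \in frac w' -> l \in frac w.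
  have [->//|li] := eqVneq l i; have [->//|lj] := eqVneq l j.
  by rewrite !inE w'l.
apply/proper_card/properP; split; first exact/fintype.subsetP.
have [h|h] := leP (1 - w i 0) (w j 0).
  by exists i => //; rewrite inE w'i /b min_l // addrCA subrr addr0 ltxx andbF.
by exists j => //; rewrite inE w'j /b min_r ?ltW // subrr ltxx.
Qed.

(** Induction on the number of fractional entries: two such entries put [w] on a segment between two
    feasible points with fewer of them, and [f] is at least [f w] at one endpoint. *)
Lemma hypersimplex_max (f : 'cV[R]_n -> R) k w :
  (forall u v t, 0 <= t <= 1 -> f (t *: u + (1 - t) *: v) <= Num.max (f u) (f v)) ->
  feasible_w k w ->
  exists2 Om : {set 'I_n}, #|Om| = k & f w <= f (\col_i (i \in Om)%:R).
Proof.
move=> qf; have [N] := ubnP #|frac w|; elim: N w => // N IH w wN fw.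
have [fr0|[i iw]] := set_0Vmem (frac w).
  have wE i : w i 0 = (w i 0 == 1)%:R.
    by apply: feasible_integral fw _; rewrite fr0 inE.
  have [sw _] := fw; exists [set i | w i 0 == 1]%SET.
    apply/eqP; rewrite -(eqr_nat R) -sw -sum1_card natr_sum big_mkcond /=.
    by apply/eqP/eq_bigr => i _; rewrite inE [RHS]wE; case: ifP.
  rewrite [X in f X <= _](_ : w = \col_i (i \in [set i | w i 0 == 1]%SET)%:R) //.
  by apply/colP => i; rewrite mxE inE -wE.
have [j /andP[ji jw]|nj] := pickP [pred j | (j != i) && (j \in frac w)].
  have [a a0 [fa ca]] := feasible_push fw ji jw iw.
  have [b b0] := feasible_push fw (negbT (introF eqP (fun e => negP ji (introT eqP (esym e))))) iw jw.
  move=> [fb cb].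
  set wa := w + _ in fa ca; set wb := w + _ in fb cb.
  have [Oa Oak Oaf] := IH wa (leq_trans ca wN) fa.
  have [Ob Obk Obf] := IH wb (leq_trans cb wN) fb.
  have ab : a + b != 0 by rewrite gt_eqF // addr_gt0.
  have := qf wa wb (b / (a + b)).
  (* The two pushes are opposite, of lengths a and b, so these weights cancel them. *)
  have -> : b / (a + b) *: wa + (1 - b / (a + b)) *: wb = w.
    by apply/colP => l; rewrite !mxE; field.
  have -> : 0 <= b / (a + b) <= 1.
    have abp : 0 < a + b by rewrite addr_gt0.
    by rewrite ltW ?divr_gt0 //= ler_pdivrMr // mul1r lerDr ltW.
  move=> /(_ isT); rewrite le_max => /orP[h|h].
    by exists Oa => //; exact: le_trans Oaf.
  by exists Ob => //; exact: le_trans Obf.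
(* A single fractional entry is incompatible with an integral sum. *)
exfalso; have [sw _] := fw.
have wl l : l != i -> w l 0 = (w l 0 == 1)%:R.
  by move=> li; apply: feasible_integral fw _; have := nj l; rewrite /= li => /negbT.
move: sw; rewrite (bigD1 i) //= (eq_bigr _ wl) -natr_sum.
set M := (\sum_(_ | _) _)%N => sw; move: iw; rewrite inE => /andP[wi0 wi1].
have : M%:R < k%:R :> R by lra.
have : k%:R < M.+1%:R :> R by rewrite -natr1; lra.
by rewrite !ltr_nat ltnS => h /(leq_ltn_trans h); rewrite ltnn.
Qed.

End Hypersimplex.

(** * Error of hard thresholding *)

Section Thresholding.
Context {R : realType} {n : nat}.
Implicit Types (u v z : 'cV[R]_n).

(** S minus T has no more elements than T minus S, and the largest magnitude on the former, at [i1],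
    bounds every magnitude there from above and every one on T from below. *)
Lemma Lk_norm2_diff k v (S T : {set 'I_n}) : is_Lk k v T -> (#|S| <= #|T|)%N ->
  norm2 (restrict_idx (S :\: T) v) <= norm2 (restrict_idx (T :\: S) v).
Proof.
move=> [_ Tmax] ST; apply: norm2_mono; rewrite -!norm2_sqr !norm2_restrictE.
have cST : (#|S :\: T| <= #|T :\: S|)%N.
  by rewrite -(leq_add2l #|S :&: T|) cardsID finset.setIC cardsID.
have [e0|[i0 i0S]] := set_0Vmem (S :\: T).
  by rewrite e0 big_set0 sumr_ge0 // => i _; rewrite sqr_ge0.
have [i1 i1S i1max] := arg_maxP (fun i => `|v i 0|) i0S.
apply: (@le_trans _ _ (\sum_(i in S :\: T) `|v i1 0| ^+ 2)).
  apply: ler_sum => i iS; rewrite -(real_normK (num_real (v i 0))).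
  rewrite ler_pXn2r ?nnegrE ?normr_ge0 //; exact: i1max.
apply: (@le_trans _ _ (\sum_(i in T :\: S) `|v i1 0| ^+ 2)).
  by rewrite !sumr_const ler_wpMn2l ?sqr_ge0.
apply: ler_sum => i; rewrite inE => /andP[_ iT].
rewrite -(real_normK (num_real (v i 0))) ler_pXn2r ?nnegrE ?normr_ge0 // Tmax //.
by have : i1 \in S :\: T := i1S; rewrite inE => /andP[].
Qed.

(** Thresholding loses only [v] on S minus T, which is no larger than [v] on T minus S; there [z]
    vanishes, so [v] equals [v - z]. *)
Lemma Hk_error k z v (S T : {set 'I_n}) :
  supp z \subset S -> is_Lk k v T -> (#|S| <= #|T|)%N ->
  norm2 (restrict_idx T v - z) <=
    norm2 (restrict_idx (T :|: S) (v - z)) + norm2 (restrict_idx (T :\: S) (v - z)).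
Proof.
move=> zS vT ST.
have z0 i : i \notin S -> z i 0 = 0.
  by move=> iS; apply/eqP; apply: contraNT iS => zi; apply: (fintype.subsetP zS); rewrite inE.
have -> : restrict_idx T v - z =
    restrict_idx (T :|: S) (v - z) - restrict_idx (S :\: T) v.
  apply/colP => i; rewrite !mxE !inE; case: (boolP (i \in T)); case: (boolP (i \in S)) => iS iT /=.
  - by rewrite subr0.
  - by rewrite subr0.
  - by rewrite addrAC subrr.
  - by rewrite z0.
apply: le_trans (norm2B _ _) _; rewrite lerD2l (le_trans (Lk_norm2_diff vT ST)) //.
rewrite [X in norm2 X <= _](_ : _ = restrict_idx (T :\: S) (v - z)) //.
by apply/colP => i; rewrite !mxE !inE; case: (boolP (i \in S)) => //= iS; rewrite z0 ?subr0.
Qed.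

End Thresholding.

(** * One iteration of the algorithm *)

Section Step.
Context {R : realType} {m n : nat}.
Variable A : 'M[R]_(m, n).

Lemma ric_upper q (z : 'cV[R]_n) : sparse q z ->
  norm2 (A *m z) <= Num.sqrt (1 + ric A q) * norm2 z.
Proof.
move=> /(ricP A)/andP[_ zq]; have d0 := ric_ge0 A q.
rewrite -(ler_pXn2r (n := 2)) ?nnegrE ?mulr_ge0 ?norm2_ge0 ?sqrtr_ge0 //.
by rewrite exprMn (sqr_sqrtr (addr_ge0 ler01 d0)).
Qed.

Lemma ric_lower q (z : 'cV[R]_n) : ric A q <= 1 -> sparse q z ->
  Num.sqrt (1 - ric A q) * norm2 z <= norm2 (A *m z).
Proof.
move=> d1 /(ricP A)/andP[zq _].
rewrite -(ler_pXn2r (n := 2)) ?nnegrE ?mulr_ge0 ?norm2_ge0 ?sqrtr_ge0 //.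
by rewrite exprMn (sqr_sqrtr (a := 1 - _)) ?subr_ge0.
Qed.

Lemma had_indicator (g : 'cV[R]_n) (Om : {set 'I_n}) :
  had g (\col_i (i \in Om)%:R) = restrict_idx Om g.
Proof. by apply/colP => i; rewrite !mxE; case: ifP; rewrite ?mulr1 ?mulr0. Qed.

Lemma feasible_indicator k (Om : {set 'I_n}) : #|Om| = k ->
  feasible_w k (\col_i (i \in Om)%:R : 'cV[R]_n).
Proof.
move=> Ok; split=> [|i]; last by rewrite mxE; case: (i \in Om); rewrite ler01 lexx.
rewrite -Ok -sum1_card natr_sum [RHS]big_mkcond; apply: eq_bigr => i _.
by rewrite mxE; case: (i \in Om).
Qed.

(** Feasible weights force k <= n, so that the [minn k n] of [is_Lk] is k. *)
Lemma feasible_le k (w : 'cV[R]_n) : feasible_w k w -> (k <= n)%N.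
Proof.
move=> [sw w01]; rewrite -(ler_nat R) -sw -[n in n%:R]card_ord -sum1_card natr_sum.
by apply: ler_sum => i _; have /andP[] := w01 i.
Qed.

(** The left side is convex in [w], hence largest at a vertex, and the Hadamard product with a
    vertex is a restriction. *)
Lemma norm2_mulmx_had_le k (g w : 'cV[R]_n) : feasible_w k w ->
  exists2 Om : {set 'I_n}, #|Om| = k &
    norm2 (A *m had g w) <= norm2 (A *m restrict_idx Om g).
Proof.
move=> fw.
have [u v t /andP[t0 t1]|Om Ok h] := hypersimplex_max (f := fun w => norm2 (A *m had g w)) _ fw.
  have -> : had g (t *: u + (1 - t) *: v) = t *: had g u + (1 - t) *: had g v.
    by apply/colP => i; rewrite !mxE; ring.
  rewrite mulmxDr -!scalemxAr (le_trans (norm2D _ _)) // !norm2Z ?subr_ge0 //.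
  set a := norm2 _; set b := norm2 _.
  have t1' : 0 <= 1 - t by rewrite subr_ge0.
  have ha : a <= Num.max a b by rewrite le_max lexx.
  have hb : b <= Num.max a b by rewrite le_max lexx orbT.
  have := ler_wpM2l t0 ha; have := ler_wpM2l t1' hb; lra.
by exists Om => //; rewrite -had_indicator.
Qed.

Variables (k : nat) (s1 sm eps lam : R).
Hypotheses (s1_ge0 : 0 <= s1) (eps_gt0 : 0 < eps) (s1_eps : s1 ^+ 2 <= eps)
  (lam_ge0 : 0 <= lam) (lam_le : lam <= eps + sm ^+ 2) (sm_s1 : sm ^+ 2 <= s1 ^+ 2)
  (Gle : forall v, dot (A^T *m v) (A^T *m v) <= s1 ^+ 2 * dot v v)
  (Gge : forall v, sm ^+ 2 * dot v v <= dot (A^T *m v) (A^T *m v)).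

Let c := s1 ^+ 2 - lam * s1 ^+ 2 / (eps + s1 ^+ 2).
Let t0 := lam * s1 / (eps + s1 ^+ 2).
Let newton (v : 'cV[R]_m) := lam *: (invmx (A^T *m A + eps%:M) *m (A^T *m v)).

Lemma newton_residual q (h : 'cV[R]_n) nu (Om : {set 'I_n}) :
  (#|Om :|: supp h| <= q)%N ->
  norm2 (restrict_idx Om (h + newton (nu - A *m h)))
    <= (ric A q + c) * norm2 h + t0 * norm2 nu.
Proof.
move=> Omq.
have -> : h + newton (nu - A *m h)
    = (h - A^T *m (A *m h)) - - ((A^T *m (A *m h) - newton (A *m h)) - - newton nu).
  rewrite /newton !mulmxBr scalerBr.
  by apply/colP => i; rewrite !mxE; ring.
rewrite restrictB; apply: le_trans (norm2B _ _) _.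
rewrite mulrDl -[leRHS]addrA; apply: lerD (rip_residual A Omq) _.
apply: le_trans (norm2_restrict_le _ _) _; rewrite norm2N.
apply: le_trans (norm2B _ _) _; rewrite norm2N.
by apply: lerD; [apply: newton_contraction Gge _|exact: newton_noise].
Qed.

(** Here [z] stands for x_S and [nu] for the effective noise A x_{S^c} + eta. *)
Lemma ntrot_step (S : {set 'I_n}) (z x x' u w : 'cV[R]_n) (y nu : 'cV[R]_m) :
  ric A (2 * k)%N < 1 ->
  #|S| = k -> supp z \subset S -> sparse k x -> y = A *m z + nu ->
  u = x + newton (y - A *m x) ->
  feasible_w k w ->
  (forall w', feasible_w k w' ->
     norm2 (y - A *m had u w) ^+ 2 <= norm2 (y - A *m had u w') ^+ 2) ->
  is_Hk k (had u w) x' ->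
  norm2 (x' - z) <=
    ((Num.sqrt (1 + ric A k) / Num.sqrt (1 - ric A (2 * k)%N)) *
      (ric A (2 * k)%N + 2 * ric A (3 * k)%N + 3 * c) + ric A (3 * k)%N + c) * norm2 (x - z)
    + ((Num.sqrt (1 - ric A (2 * k)%N))^-1 * (3 * t0 * Num.sqrt (1 + ric A k) + 2) + t0)
      * norm2 nu.
Proof.
move=> d2_lt1 Sk zS xk yE uE fw wmin [T [vT ->]].
have Tk : (#|T| <= k)%N by rewrite vT.1 geq_minl.
have kn := feasible_le fw.
have ST : (#|S| <= #|T|)%N by rewrite vT.1 Sk (minn_idPl kn).
set h := x - z; set r := h + newton (nu - A *m h).
have urz : u = r + z.
  rewrite /r; have <- : y - A *m x = nu - A *m h.
    by rewrite yE /h mulmxBr; apply/colP => i; rewrite !mxE; ring.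
  by rewrite uE /h addrAC subrK.
have hS : supp h \subset supp x :|: S.
  apply/fintype.subsetP => i; rewrite !inE !mxE; apply: contraNT.
  rewrite negb_or negbK => /andP[/eqP -> iS]; rewrite sub0r oppr_eq0.
  by apply: contraNT iS => zi; apply: (fintype.subsetP zS); rewrite inE.
have card_xS : (#|supp x :|: S| <= 2 * k)%N.
  by rewrite (leq_trans (leq_card_setU _ _)) // mul2n -addnn leq_add // Sk.
(* On S the support to control stays inside [supp x :|: S], so order 2k suffices; an arbitrary k-set
   adds k indices and needs order 3k. *)
set R2 := (ric A (2 * k) + c) * norm2 h + t0 * norm2 nu.
set R3 := (ric A (3 * k) + c) * norm2 h + t0 * norm2 nu.
have rS : norm2 (restrict_idx S r) <= R2.
  apply: newton_residual; apply: leq_trans card_xS; apply: subset_leq_card.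
  by rewrite finset.subUset finset.subsetUr hS.
have rOm (Om : {set 'I_n}) : (#|Om| <= k)%N -> norm2 (restrict_idx Om r) <= R3.
  move=> Omk; apply: newton_residual; rewrite (leq_trans (leq_card_setU _ _)) //.
  rewrite mulSn leq_add // (leq_trans _ card_xS) //; exact: subset_leq_card.
have z0 i : i \notin S -> z i 0 = 0.
  by move=> iS; apply/eqP; apply: contraNT iS => zi; apply: (fintype.subsetP zS); rewrite inE.
(* Off S the vector [z] vanishes, so the error is exactly [r] weighted by [w]. *)
have off (V : {set 'I_n}) : (forall i, i \in V -> i \notin S) ->
    restrict_idx V (had u w - z) = had (restrict_idx V r) w.
  move=> VS; apply/colP => i; rewrite urz !mxE; case: ifPn => iV; last by rewrite mul0r.
  by rewrite z0 ?VS // addr0 subr0.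
have had_le (g : 'cV[R]_n) : norm2 (had g w) <= norm2 g.
  apply: norm2_mono; rewrite !dotE; apply: ler_sum => i _; rewrite !mxE.
  have /andP[w0 w1] := fw.2 i; rewrite -!expr2 exprMn ler_piMr ?sqr_ge0 //.
  by rewrite expr_le1.
apply: le_trans (Hk_error zS vT ST) _.
have B2 : norm2 (restrict_idx (T :\: S) (had u w - z)) <= R3.
  rewrite off; last by move=> i; rewrite inE => /andP[].
  apply: le_trans (had_le _) (rOm _ _).
  by rewrite (leq_trans _ Tk) // subset_leq_card // finset.subsetDl.
set V := T :|: S.
have Vk : (#|V| <= 2 * k)%N.
  by rewrite (leq_trans (leq_card_setU _ _)) // mul2n -addnn leq_add // Sk.
set a := Num.sqrt (1 + ric A k); set b := Num.sqrt (1 - ric A (2 * k)).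
have b0 : 0 < b by rewrite sqrtr_gt0 subr_gt0.
(* Isometry on the 2k-sparse part V; its image is [nu] minus the residual minus the image of the
   tail off V. *)
have B1 : b * norm2 (restrict_idx V (had u w - z)) <= 2 * norm2 nu + a * R2 + a * R3.
  apply: le_trans (ric_lower (ltW d2_lt1) (sparse_restrict _ Vk)) _.
  have -> : A *m restrict_idx V (had u w - z)
      = (nu - (y - A *m had u w)) - A *m restrict_idx (~: V) (had u w - z).
    have -> : restrict_idx V (had u w - z)
        = (had u w - z) - restrict_idx (~: V) (had u w - z).
      by apply/colP => i; rewrite !mxE !inE; case: ifP; rewrite ?subr0 ?subrr.
    by rewrite yE !mulmxBr; apply/colP => i; rewrite !mxE; ring.
  rewrite off; last by move=> i; rewrite !inE negb_or => /andP[].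
  have [Om Omk hOm] := norm2_mulmx_had_le (restrict_idx (~: V) r) fw.
  have H1 : norm2 (A *m restrict_idx Om (restrict_idx (~: V) r)) <= a * R3.
    rewrite restrict_restrict.
    have ck : (#|Om :&: ~: V| <= k)%N by rewrite -Omk subset_leq_card // finset.subsetIl.
    apply: le_trans (ric_upper (sparse_restrict _ ck)) _.
    by rewrite ler_wpM2l ?sqrtr_ge0 // rOm.
  (* Optimality of [w] against the indicator of S, whose residual is nu - A r_S. *)
  have H2 : norm2 (y - A *m had u w) <= norm2 nu + a * R2.
    have := wmin _ (feasible_indicator Sk).
    rewrite ler_pXn2r ?nnegrE ?norm2_ge0 // => /le_trans; apply.
    rewrite had_indicator.
    have -> : y - A *m restrict_idx S u = nu - A *m restrict_idx S r.
      have -> : restrict_idx S u = restrict_idx S r - - z.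
        by apply/colP => i; rewrite urz !mxE opprK; case: ifPn => // iS; rewrite z0 ?addr0.
      by rewrite yE mulmxBr mulmxN; apply/colP => i; rewrite !mxE; ring.
    rewrite (le_trans (norm2B _ _)) // lerD2l.
    have ck : (#|S| <= k)%N by rewrite Sk.
    apply: le_trans (ric_upper (sparse_restrict _ ck)) _.
    by rewrite ler_wpM2l ?sqrtr_ge0.
  apply: le_trans (norm2B _ _) _; have := norm2B nu (y - A *m had u w); lra.
have ? := norm2_ge0 h; have ? := norm2_ge0 nu; have ? := ric_ge0 A (3 * k).
have ? : 0 <= c by exact: newton_coef_ge0 lam_le sm_s1.
have t00 : 0 <= t0 by rewrite divr_ge0 ?mulr_ge0 ?addr_ge0 ?sqr_ge0 // ltW.
have R30 : 0 <= R3 by rewrite addr_ge0 // mulr_ge0 // addr_ge0.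
have a0 : 0 <= a by rewrite sqrtr_ge0.
(* A second copy of a R3 is added to match the constants of the conclusion. *)
have B3 : norm2 (restrict_idx V (had u w - z))
    <= b^-1 * (2 * norm2 nu + a * R2 + 2 * (a * R3)).
  rewrite mulrC ler_pdivlMr // mulrC (le_trans B1) //.
  have := mulr_ge0 a0 R30; lra.
apply: le_trans (lerD B3 B2) _.
by rewrite le_eqVlt; apply/orP; left; apply/eqP; rewrite /R2 /R3; ring.
Qed.

End Step.

(** * Sparse vectors and their largest entries *)

Section Support.
Context {R : realType} {n : nat}.

(** A nonzero entry outside S would make all entries on S nonzero, so the support would have more
    than min(k, n) elements. *)
Lemma Lk_sparse_supp k (x : 'cV[R]_n) (S : {set 'I_n}) :
  is_Lk k x S -> sparse k x -> supp x \subset S.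
Proof.
move=> [Sk Smax] xk; apply/fintype.subsetP => i; rewrite inE => xi.
apply: contraT => iS; have SX : i |: S \subset supp x.
  apply/fintype.subsetP => j; rewrite !inE => /orP[/eqP -> //|jS].
  by rewrite -normr_gt0 (lt_le_trans _ (Smax _ _ jS iS)) // normr_gt0.
have := subset_leq_card SX; rewrite cardsU1 iS add1n Sk => h.
have [kn|kn] := leqP k n.
  by move: h; rewrite (minn_idPl kn) ltnNge => /negP; case.
by have := leq_trans h (max_card _); rewrite card_ord (minn_idPr (ltnW kn)) ltnn.
Qed.

End Support.

(** * Contraction factor, error bound and convergence *)

Unset Implicit Arguments.
Set Strict Implicit.

Theorem theorem2 (R : realType) (m n : nat) (A : 'M[R]_(m, n))
  (x : 'cV[R]_n) (eta : 'cV[R]_m) (y : 'cV[R]_m) (k : nat)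
  (Sx : {set 'I_n}) (s1 sm eps lam : R) (xs us ws : nat -> 'cV[R]_n) :
  (m < n)%N ->
  y = A *m x + eta ->
  (1 <= k)%N ->
  is_Lk k x Sx ->
  is_singular_value A s1 -> (forall s, is_singular_value A s -> s <= s1) ->
  is_singular_value A sm -> (forall s, is_singular_value A s -> sm <= s) ->
  let d1 := ric A k in
  let d2 := ric A (2 * k)%N in
  let d3 := ric A (3 * k)%N in
  let gamma := 1 / (3 * Num.sqrt ((1 + d3) / (1 - d3)) + 1) in
  d3 < 2119 / 10000 ->
  0 < eps -> 0 < lam ->
  s1 ^+ 2 < eps ->
  ((s1 ^+ 2 - sm ^+ 2) / (gamma - d3) - 1) * s1 ^+ 2 < eps ->
  eps + s1 ^+ 2 + (d3 - gamma) * (eps + s1 ^+ 2) / s1 ^+ 2 < lam ->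
  lam <= eps + sm ^+ 2 ->
  NTROT_seq A y k eps lam xs us ws ->
  let rho := Num.sqrt ((1 + d1) / (1 - d2)) *
               (d2 + 2 * d3 + 3 * s1 ^+ 2 - 3 * lam * s1 ^+ 2 / (eps + s1 ^+ 2))
             + d3 + s1 ^+ 2 - lam * s1 ^+ 2 / (eps + s1 ^+ 2) in
  let tau := 1 / Num.sqrt (1 - d2) *
               (3 * lam * s1 * Num.sqrt (1 + d1) / (eps + s1 ^+ 2) + 2)
             + lam * s1 / (eps + s1 ^+ 2) in
  rho < 1 /\
  (forall p : nat, sparse k (xs p.+1)) /\
  (forall p : nat, sparse k (xs p) ->
     norm2 (xs p.+1 - restrict_idx Sx x)
       <= rho * norm2 (xs p - restrict_idx Sx x)
          + tau * norm2 (A *m restrict_idx (~: Sx)%SET x + eta)) /\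
  (sparse k x -> eta = 0 ->
     (fun p => norm2 (xs p - x)) @ \oo --> (0 : R)).
Proof.
move=> mn yE k1 xSx s1sv s1max smsv smmin d1 d2 d3 gamma d3lt eps0 lam0 s1eps _ lamgt lamle seq rho tau.
have s10 : 0 <= s1 by case: s1sv.
have sm0 : 0 <= sm by case: smsv.
have m0 : (0 < m)%N.
  case: s1sv => _ /eigenvalueP[v _]; apply: contraNltn; rewrite leqn0 => /eqP m0.
  by apply/eqP/rowP => i; have := ltn_ord i; rewrite {2}m0.
have sms1 : sm ^+ 2 <= s1 ^+ 2 by rewrite ler_pXn2r ?nnegrE // s1max.
set D := eps + s1 ^+ 2 in lamgt rho tau *.
have D0 : 0 < D by rewrite ltr_pwDl ?sqr_ge0.
(* Division by zero yields 0, so s1 = 0 would turn the lower bound on [lam] into eps < lam, against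
   lam <= eps + sm^2 = eps. *)
have s1p : 0 < s1 ^+ 2.
  rewrite lt_def sqr_ge0 andbT; apply/eqP => s12; move: lamgt; rewrite /D s12 invr0 mulr0.
  by move: sms1 lamle; rewrite s12; lra.
set c := s1 ^+ 2 - lam * s1 ^+ 2 / D.
have c0 : 0 <= c by exact: newton_coef_ge0 lamle sms1.
(* This is the lower bound on [lam] multiplied by s1^2 / D. *)
have clt : c < gamma - d3.
  rewrite /c; have DN : D != 0 by rewrite gt_eqF.
  have sN : s1 ^+ 2 != 0 by rewrite gt_eqF.
  have := lamgt; rewrite -(ltr_pM2r (divr_gt0 s1p D0)).
  have -> : (D + (d3 - gamma) * D / s1 ^+ 2) * (s1 ^+ 2 / D) = s1 ^+ 2 + (d3 - gamma).
    by field; rewrite DN -sqrf_eq0.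
  by rewrite mulrA; lra.
have d12 : d1 <= d2 by apply: ric_mono; rewrite leq_pmull.
have d23 : d2 <= d3 by apply: ric_mono; rewrite leq_mul2r orbT.
have d10 : 0 <= d1 by exact: ric_ge0.
have d3lt1 : d3 < 1 by lra.
have d2lt1 : d2 < 1 by lra.
have rhoE : rho = Num.sqrt ((1 + d1) / (1 - d2)) * (d2 + 2 * d3 + 3 * c) + d3 + c.
  by rewrite /rho /c; ring.
have tauE : tau = (Num.sqrt (1 - d2))^-1
    * (3 * (lam * s1 / D) * Num.sqrt (1 + d1) + 2) + lam * s1 / D.
  by rewrite /tau; ring.
have rho0 : 0 <= rho.
  have d20 := le_trans d10 d12; have d30 := le_trans d20 d23.
  have B0 : 0 <= d2 + 2 * d3 + 3 * c by lra.
  by rewrite rhoE; exact: addr_ge0 (addr_ge0 (mulr_ge0 (sqrtr_ge0 _) B0) d30) c0.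
(* By monotonicity of the constants rho <= (d3 + c)(3 q + 1), and gamma = 1 / (3 q + 1). *)
have rho1 : rho < 1.
  rewrite rhoE; set q := Num.sqrt ((1 + d3) / (1 - d3)).
  have qle : Num.sqrt ((1 + d1) / (1 - d2)) <= q.
    rewrite ler_wsqrtr // ler_pM ?invr_ge0 //; try lra.
    by rewrite lef_pV2 ?posrE; lra.
  have q0 : 0 <= q by rewrite sqrtr_ge0.
  have K0 : 0 < 3 * q + 1 by lra.
  have : (d3 + c) * (3 * q + 1) < 1.
    by rewrite -ltr_pdivlMr // -/gamma; move: clt; rewrite /gamma -/q; lra.
  have : Num.sqrt ((1 + d1) / (1 - d2)) * (d2 + 2 * d3 + 3 * c) <= q * (3 * d3 + 3 * c).
    by rewrite ler_pM ?sqrtr_ge0 //; lra.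
  lra.
have kn : (k <= n)%N by have [_ [[fw _] _]] := seq 0%N; exact: feasible_le fw.
have Sk : #|Sx| = k by rewrite xSx.1 (minn_idPl kn).
have xs_sparse p : sparse k (xs p.+1).
  have [_ [_ [T [[Tk _] ->]]]] := seq p.
  by apply: sparse_restrict; rewrite Tk geq_minl.
have step p : sparse k (xs p) -> norm2 (xs p.+1 - restrict_idx Sx x)
    <= rho * norm2 (xs p - restrict_idx Sx x)
       + tau * norm2 (A *m restrict_idx (~: Sx)%SET x + eta).
  move=> xpk; have [uE [[fw wmin] Hk]] := seq p.
  have yE' : y = A *m restrict_idx Sx x + (A *m restrict_idx (~: Sx)%SET x + eta).
    rewrite addrA -mulmxDr yE; congr (A *m _ + _).
    by apply/colP => i; rewrite !mxE inE; case: ifP; rewrite ?addr0 ?add0r.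
  rewrite rhoE tauE sqrtrM ?sqrtrV; try lra.
  exact: (ntrot_step s10 eps0 (ltW s1eps) (ltW lam0) lamle sms1 (gram_le m0 s1max)
    (gram_ge m0 sm0 smmin) d2lt1 Sk (supp_restrict _ _) xpk yE' uE fw wmin Hk).
split=> //; split=> //; split=> // xk eta0.
have xSxE : restrict_idx Sx x = x by apply: restrict_supp; exact: Lk_sparse_supp xSx xk.
have noise0 : A *m restrict_idx (~: Sx)%SET x + eta = 0.
  rewrite eta0 addr0 [X in A *m X](_ : _ = 0) ?mulmx0 //.
  by rewrite -{1}xSxE restrict_restrict finset.setIC finset.setICr; apply/colP => i; rewrite !mxE inE.
(* The iteration of the bound starts at index 1, since [xs 0] may fail to be sparse. *)
have geo p : norm2 (xs p.+1 - x) <= norm2 (xs 1%N - x) * rho ^+ p.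
  elim: p => [|p IH]; first by rewrite expr0 mulr1.
  have := step _ (xs_sparse p); rewrite xSxE noise0 norm2_0 mulr0 addr0 => h.
  by rewrite (le_trans h) // exprS mulrCA ler_wpM2l.
rewrite -cvg_shiftS /=.
apply: (@squeeze_cvgr _ _ _ _ (cst 0) (geometric (norm2 (xs 1%N - x)) rho)).
- by apply: nearW => p; rewrite norm2_ge0 /= geo.
- exact: cvg_cst.
- by apply: cvg_geometric; rewrite ger0_norm.
Qed.
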